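(* Let $r\in[2,\infty)$, let $(X,\|\cdot\|)$ be an $r$-uniformly convex space with constant $c_r$, and let $\alpha\in(0,1)$. Then every $\alpha$-averaged operator $T:X\to X$ is $\alpha$-firmly nonexpansive.
   Context: For $r\in[2,\infty)$, a normed space $(X,\|\cdot\|)$ is called $r$-uniformly convex (with constant $c_r$) if there is a constant $c_r>0$ such that for all $w\in[0,1]$ and all $x,y\in X$ $$\|(1-w)x+wy\|^r\le(1-w)\|x\|^r+w\|y\|^r-\frac{c_r}{2}w(1-w)\|x-y\|^r.$$ The constant $c_r$ is fixed. Operators are maps $X\to X$, not necessarily linear; $\mathrm{I}$ is the identity. $R$ is nonexpansive if $\|Rx-Ry\|\le\|x-y\|$ for all $x,y\in X$. $T:X\to X$ is $\alpha$-averaged if there is a nonexpansive $R:X\to X$ with $T=(1-\alpha)\mathrm{I}+\alpha R$. $T:X\to X$ is $\alpha$-firmly nonexpansive if for all $x,y\in X$ $$\|Tx-Ty\|^r\le\|x-y\|^r-\frac{c_r}{2}\,\frac{1-\alpha}{\alpha}\,\|(\mathrm{I}-T)x-(\mathrm{I}-T)y\|^r.$$ *)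

(* Defs.v *)
From mathcomp Require Import all_boot all_order all_algebra.
From mathcomp Require Import reals topology normedtype exp.
Set Implicit Arguments.
Unset Strict Implicit.
Unset Printing Implicit Defensive.
Import Order.TTheory GRing.Theory Num.Theory.
Import numFieldNormedType.Exports.
Local Open Scope ring_scope.

(* [a `^ r] is the real power [powR]; its value [0 `^ r = 0] for [r != 0] is
   the usual one, so norms may vanish below. *)

Definition uniformly_convex (R : realType) (X : normedModType R) (r c : R) :
    Prop :=
  0 < c /\
  forall (w : R) (x y : X), 0 <= w <= 1 ->
    `|(1 - w) *: x + w *: y| `^ r <=
      (1 - w) * `|x| `^ r + w * `|y| `^ r
      - c / 2 * w * (1 - w) * `|x - y| `^ r.

Definition nonexpansive (R : realType) (X : normedModType R) (S : X -> X) :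
    Prop :=
  forall x y : X, `|S x - S y| <= `|x - y|.

Definition averaged (R : realType) (X : normedModType R) (alpha : R)
    (T : X -> X) : Prop :=
  exists2 S : X -> X, nonexpansive S &
    forall x : X, T x = (1 - alpha) *: x + alpha *: S x.

Definition firmly_nonexpansive (R : realType) (X : normedModType R)
    (r c alpha : R) (T : X -> X) : Prop :=
  forall x y : X,
    `|T x - T y| `^ r <=
      `|x - y| `^ r
      - c / 2 * ((1 - alpha) / alpha) * `|(x - T x) - (y - T y)| `^ r.

(* Main.v *)
Require Import Defs.
From mathcomp Require Import all_boot all_order all_algebra.
From mathcomp Require Import reals topology normedtype exp.
From mathcomp Require Import ring.
Import Order.TTheory GRing.Theory Num.Theory.
Import numFieldNormedType.Exports.
Local Open Scope ring_scope.

(** Write [T = (1 - alpha) I + alpha S] with [S] nonexpansive, and put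
    [u = x - y], [v = S x - S y].  Then [T x - T y] is the convex combination
    [(1 - alpha) u + alpha v], so uniform convexity with weight [alpha] bounds
    its [r]-th power; as [|v| <= |u|], the two convex terms collapse to
    [|u|^r].  The residual difference [(I - T) x - (I - T) y] equals
    [alpha (u - v)], so firm nonexpansiveness asks for the correction
    [c/2 * (1 - alpha) / alpha * alpha^r * |u - v|^r], while uniform convexity
    supplies [c/2 * alpha (1 - alpha) * |u - v|^r].  The latter is at least
    the former because [alpha^r <= alpha^2], which is where [2 <= r] enters
    ([powR_div_le]). *)

(** This is [a^r <= a^2] divided by [a]: powers of [a <= 1] decrease in the
    exponent, and for [a < 1] the exponent [2] is exactly the threshold. *)
Lemma powR_div_le (R : realType) (a r : R) :
  0 < a <= 1 -> 2 <= r -> a `^ r / a <= a.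
Proof.
move=> a01 r2; have /andP[a0 _] := a01.
rewrite ler_pdivrMr // -expr2 -(powR_mulrn 2 (ltW a0)).
exact: ger_powR.
Qed.

Theorem proposition3p6 (R : realType) (X : normedModType R) (r c alpha : R)
    (hr : 2 <= r) (hX : uniformly_convex X r c) (halpha : 0 < alpha < 1)
    (T : X -> X) (hT : averaged alpha T) :
  firmly_nonexpansive r c alpha T.
Proof.
case: hX => c0 ucX; case: hT => S Sne TE x y.
have /andP[a0 a1] := halpha.
have r0 : 0 <= r by exact: le_trans hr.
set u := x - y; set v := S x - S y.
have TuvE : T x - T y = (1 - alpha) *: u + alpha *: v.
  by rewrite !TE !scalerBr opprD addrACA.
have residual z : z - T z = alpha *: (z - S z).
  by rewrite TE scalerBl scale1r scalerBr opprD opprB addrA addrCA subrr addr0.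
have resE : (x - T x) - (y - T y) = alpha *: (u - v).
  by rewrite !residual -scalerBr /u /v !opprD addrACA.
rewrite resE normrZ gtr0_norm // (powRM _ (ltW a0)) // TuvE.
have vu : `|v| `^ r <= `|u| `^ r by rewrite ge0_ler_powR ?nnegrE ?Sne.
have a01 : 0 <= alpha <= 1 by rewrite !ltW.
apply: le_trans (ucX _ u v a01) _; apply: lerB.
  rewrite [leRHS](_ : _ = (1 - alpha) * `|u| `^ r + alpha * `|u| `^ r).
    by rewrite lerD2l (ler_wpM2l (ltW a0)).
  by rewrite -mulrDl subrK mul1r.
set d := `|u - v| `^ r.
have -> : c / 2 * ((1 - alpha) / alpha) * (alpha `^ r * d) =
          c / 2 * (1 - alpha) * d * (alpha `^ r / alpha) by ring.
have -> : c / 2 * alpha * (1 - alpha) * d =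
          c / 2 * (1 - alpha) * d * alpha by ring.
apply: ler_wpM2l; last by rewrite powR_div_le // a0 ltW.
by rewrite !mulr_ge0 ?powR_ge0 ?invr_ge0 ?subr_ge0 // ltW.
Qed.
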